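(* There is a function $f:[1,\infty)\to\mathbb{N}$ such that every finite tournament $T$ satisfies $\gamma^+(T)\leq f(\chi^a_f(T))$.
   Context: A tournament is a digraph in which every two distinct vertices are joined by exactly one arc. $N^-[v]$ denotes $v$ together with its in-neighbours. The domination number $\gamma^+(T)$ is the minimum size of a set $X$ with $N^-[v]\cap X\neq\emptyset$ for every vertex $v$. The fractional acyclic chromatic number $\chi^a_f(T)$ is the minimum total weight of a nonnegative weighting of the transitive (i.e. acyclic) induced subtournaments of $T$ such that for each vertex $v$ the weights of subtournaments containing $v$ sum to at least 1. *)

(* Defs.v *)
From mathcomp Require Import all_boot all_order all_algebra.
From mathcomp Require Import boolp classical_sets reals.
Set Implicit Arguments. Unset Strict Implicit. Unset Printing Implicit Defensive.
Import Order.TTheory GRing.Theory Num.Theory.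

(* A tournament on a finite vertex type T, with arc relation a (a u v = arc u -> v):
   irreflexive, and any two distinct vertices joined by exactly one arc. *)
Definition is_tournament (T : finType) (a : rel T) : Prop :=
  (forall x, ~~ a x x) /\ (forall x y, x != y -> (a x y (+) a y x) = true).

Definition dominating (T : finType) (a : rel T) (X : {set T}) : bool :=
  [forall v, [exists x in X, (x == v) || a x v]].

(* gamma^+(T): minimum size of a dominating set (setT is always dominating). *)
Definition domination_number (T : finType) (a : rel T) : nat :=
  #|[arg min_(X < [set: T] | dominating a X) #|X|]|.

(* S induces a transitive (acyclic) subtournament. *)
Definition transitive_set (T : finType) (a : rel T) (S : {set T}) : bool :=
  [forall x in S, forall y in S, forall z in S, a x y ==> a y z ==> a x z].

Local Open Scope ring_scope.

Definition frac_acyclic_colouring (R : realType) (T : finType) (a : rel T)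
    (w : {ffun {set T} -> R}) : Prop :=
  (forall S, 0 <= w S) /\ (forall S, ~~ transitive_set a S -> w S = 0) /\
  (forall v : T, 1 <= \sum_(S | transitive_set a S && (v \in S)) w S).

Definition total_weight (R : realType) (T : finType) (a : rel T)
    (w : {ffun {set T} -> R}) : R :=
  \sum_(S | transitive_set a S) w S.

(* chi^a_f(T): minimum (infimum; the LP minimum is attained) total weight. *)
Definition frac_acyclic_chromatic (R : realType) (T : finType) (a : rel T) : R :=
  inf [set total_weight a w | w in [set w | frac_acyclic_colouring a w]].

(* Main.v *)
(* Let [w] be a fractional acyclic colouring of total weight [C]. For vertices
   [u], [v] let [M u v] be the weight of the transitive sets containing both if
   [u = v] or [u -> v], and [0] otherwise. Every distribution [x] on vertices has
   [sum_{u,v} x u * x v * M u v >= 1 / (2C)], hence some [u] has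
   [sum_v x v * M u v >= 1 / (2C)], and by minimax there is a distribution [p]
   with [sum_u p u * M u v >= 1 / (4C)] for all [v] at once. So for each [v] the
   transitive sets in which the vertices up to [v] have [p]-mass at least
   [b = 1 / (8C^2)] have weight at least [1 / (8C)]. Call such [v] heavy in [Z].
   A bounded number of vertices hits, in all [Z] but a weight less than
   [1 / (8C)], the prefix of [Z] ending at its first heavy vertex; every [v] is
   then heavy in some hit [Z], and by transitivity it is dominated. *)
Require Import Defs.
From mathcomp Require Import all_boot all_order all_algebra.
From mathcomp Require Import boolp classical_sets reals.
From mathcomp Require Import ring lra.
From mathcomp Require Import finset.
Set Implicit Arguments. Unset Strict Implicit. Unset Printing Implicit Defensive.
Import Order.TTheory GRing.Theory Num.Theory.
Local Open Scope ring_scope.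

(** * Averaging and an approximate minimax theorem *)

Lemma sum_bool_count (V : Type) (p : pred V) (s : seq V) :
  (\sum_(u <- s) p u)%N = count p s.
Proof. by rewrite -sum1_count [RHS]big_mkcond; apply: eq_bigr => u _; case: (p u). Qed.

Lemma seq_mean_le (R : realType) (V : eqType) (F : V -> R) (c : R) (s : seq V) :
  (0 < size s)%N -> (size s)%:R * c <= \sum_(u <- s) F u ->
  exists2 u, u \in s & c <= F u.
Proof.
move=> s0 h; apply: contrapT => hn.
have lt u : u \in s -> F u < c.
  by move=> us; rewrite ltNge; apply/negP => cF; apply: hn; exists u.
suff : \sum_(u <- s) F u < (size s)%:R * c by rewrite ltNge h.
have -> : (size s)%:R * c = \sum_(u <- s) c.
  by rewrite big_const_seq count_predT iter_addr_0 mulr_natl.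
clear h hn; case: s s0 lt => // v s _ lt; rewrite !big_cons; apply: ltr_leD.
  by apply: lt; rewrite mem_head.
rewrite big_seq [leRHS]big_seq; apply: ler_sum => u us.
by apply/ltW/lt; rewrite inE us orbT.
Qed.

(** One round of approachability: as [x - y <= max 0 x - y], a deficit may be replaced by its
    positive part before [y] is subtracted. *)
Lemma sqr_pos_part_le (R : realType) (x y : R) :
  Num.max 0 (x - y) ^+ 2 <= (Num.max 0 x - y) ^+ 2.
Proof.
have [h1|h1] := leP 0 (x - y); have [h2|h2] := leP 0 x; rewrite ?expr0n /=; nra.
Qed.

(* The squared distance of [t * d - sum_(u <- s) M u] to the negative orthant
   grows at most linearly in [t] when every new [u] is the reply to its positive
   part (Blackwell's approachability argument). *)
Lemma approx_minimax (R : realType) (V I : finType) (M : V -> I -> R) (d d' : R) :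
  (forall x : I -> R, (forall v, 0 <= x v) ->
     exists u, d * \sum_v x v <= \sum_v x v * M u v) ->
  d' < d ->
  exists2 s : seq V, (0 < size s)%N &
    forall v, (size s)%:R * d' <= \sum_(u <- s) M u v.
Proof.
move=> reply ltd.
pose B := \sum_u \sum_v (M u v - d) ^+ 2.
have B_ge u : \sum_v (M u v - d) ^+ 2 <= B.
  rewrite /B (bigD1 u) //= lerDl; apply: sumr_ge0 => u' _.
  by apply: sumr_ge0 => v _; apply: sqr_ge0.
have B0 : 0 <= B by apply: sumr_ge0 => u _; apply: sumr_ge0 => v _; apply: sqr_ge0.
have play t : exists2 s : seq V, size s = t &
    \sum_v Num.max 0 (t%:R * d - \sum_(u <- s) M u v) ^+ 2 <= t%:R * B.
  elim: t => [|t [s szs IH]].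
    by exists [::] => //; rewrite !mul0r big1// => v _; rewrite big_nil subrr maxxx expr0n.
  pose x v := Num.max 0 (t%:R * d - \sum_(u <- s) M u v).
  have [|u hu] := reply x; first by move=> v; rewrite le_max lexx.
  exists (u :: s); first by rewrite /= szs.
  (* By the choice of [u] the cross term only lowers the sum, so a round adds at most [B]. *)
  have : \sum_v (x v - (M u v - d)) ^+ 2 <= t.+1%:R * B.
    have -> : \sum_v (x v - (M u v - d)) ^+ 2 = \sum_v x v ^+ 2
        - 2 * (\sum_v x v * M u v - d * \sum_v x v) + \sum_v (M u v - d) ^+ 2.
      rewrite mulr_sumr -sumrB mulr_sumr -sumrB -big_split /=.
      by apply: eq_bigr => v _; ring.
    have := B_ge u; rewrite -natr1 mulrDl mul1r; move: IH hu; rewrite -/x.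
    by lra.
  apply: le_trans; apply: ler_sum => v _; rewrite big_cons.
  have -> : t.+1%:R * d - (M u v + \sum_(j <- s) M j v)
     = t%:R * d - \sum_(j <- s) M j v - (M u v - d) by rewrite -natr1; ring.
  exact: sqr_pos_part_le.
have e0 : 0 < (d - d') ^+ 2 by rewrite exprn_gt0// subr_gt0.
(* So large that a single coordinate below [t * d'] has a squared deficit above [t * B]. *)
pose t := (Num.truncn (B / (d - d') ^+ 2)).+1.
have tB : B < t%:R * (d - d') ^+ 2.
  by rewrite -ltr_pdivrMr//; apply: truncnS_gt.
have [s szs hs] := play t.
exists s; rewrite szs // => v; rewrite leNgt; apply/negP => lt_v.
set S := \sum_(u <- s) M u v in lt_v.
have t0 : 0 < t%:R :> R by rewrite ltr0n.
have hv : Num.max 0 (t%:R * d - S) ^+ 2 <= t%:R * B.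
  by apply: le_trans hs; rewrite (bigD1 v) //= lerDl sumr_ge0// => ? _; apply: sqr_ge0.
have gap : 0 < t%:R * (d - d') < t%:R * d - S.
  by apply/andP; split; [rewrite mulr_gt0 // subr_gt0 | lra].
case/andP: gap => g0 g1.
have : t%:R * B < (t%:R * (d - d')) ^+ 2.
  by rewrite exprMn expr2 -mulrA ltr_pM2l.
have : (t%:R * (d - d')) ^+ 2 <= Num.max 0 (t%:R * d - S) ^+ 2.
  rewrite ler_sqr ?nnegrE ?(ltW g0) ?le_max ?lexx//.
  by rewrite (ltW g1) orbT.
by lra.
Qed.

(** * Greedy hitting sets and geometric decay *)

(** On average over [s], a vertex hits at least a fraction [b] of the weight not hit so far; adding
    one that does so shrinks the rest by a factor [1 - b]. *)
Lemma greedy_hitting_set (R : realType) (V I : finType) (h : V -> I -> bool)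
    (P : pred I) (w : I -> R) (s : seq V) (b : R) (n : nat) :
  (forall i, 0 <= w i) -> (0 < size s)%N -> b <= 1 ->
  (forall i, P i -> (size s)%:R * b <= (count (h^~ i) s)%:R) ->
  exists2 X : {set V}, (#|X| <= n)%N &
    \sum_(i | P i && [forall u in X, ~~ h u i]) w i
      <= (1 - b) ^+ n * \sum_(i | P i) w i.
Proof.
move=> w0 s0 b1 dense; elim: n => [|n [X cX IH]].
  exists set0; rewrite ?cards0// expr0 mul1r le_eqVlt; apply/orP; left; apply/eqP.
  apply: eq_bigl => i; rewrite [X in _ && X](_ : _ = true) ?andbT//.
  by apply/forallP => u; rewrite inE.
pose Q i := P i && [forall u in X, ~~ h u i].
have [||u us hu] := @seq_mean_le _ _
    (fun u => \sum_(i | Q i) w i * (h u i)%:R) (b * \sum_(i | Q i) w i) s.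
- by [].
- rewrite exchange_big /= mulrA mulr_sumr; apply: ler_sum => i /andP[Pi _].
  rewrite -mulr_sumr mulrC; apply: ler_wpM2l => //.
  by rewrite -natr_sum sum_bool_count dense.
exists (u |: X).
  by rewrite cardsU1 -add1n; apply: leq_add => //; case: (u \notin X).
have -> : \sum_(i | P i && [forall y in u |: X, ~~ h y i]) w i =
    \sum_(i | Q i) w i - \sum_(i | Q i) w i * (h u i)%:R.
  rewrite -sumrB [RHS](bigID (h u)) /= [X in _ = X + _]big1 ?add0r; last first.
    by move=> i /andP[_ ->]; rewrite mulr1 subrr.
  apply: eq_big => i; last first.
    move=> /andP[_ /forallP/(_ u)]; rewrite setU11 /= => /negbTE ->.
    by rewrite mulr0 subr0.
  rewrite /Q -andbA; congr (_ && _); apply/forall_inP/andP.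
    move=> H; split; last by apply: H; rewrite setU11.
    by apply/forall_inP => y yX; apply: H; rewrite setU1r.
  by case=> /forall_inP H hu' y /setU1P[->//|/H].
rewrite exprS -mulrA; apply: (@le_trans _ _ ((1 - b) * \sum_(i | Q i) w i)).
  by move: hu; lra.
by apply: ler_wpM2l; rewrite ?subr_ge0.
Qed.

Lemma bernoulli_decay (R : realType) (b : R) (n : nat) :
  0 <= b <= 1 -> (1 - b) ^+ n * (1 + n%:R * b) <= 1.
Proof.
case/andP=> b0 b1; elim: n => [|n IH]; first by rewrite expr0; lra.
apply: le_trans IH; rewrite exprSr -mulrA ler_wpM2l ?exprn_ge0 ?subr_ge0//.
rewrite -natr1; have : 0 <= n%:R * b ^+ 2 by rewrite mulr_ge0 ?sqr_ge0.
have := sqr_ge0 b; nra.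
Qed.

(** Bernoulli bounds [(1 - b) ^+ n] by [1 / (1 + n * b)], so any [n > C / (e * b)] will do. *)
Lemma geometric_small (R : realType) (C b e : R) :
  0 <= C -> 0 < b <= 1 -> 0 < e -> exists n : nat, (1 - b) ^+ n * C < e.
Proof.
move=> C0 /andP[b0 b1] e0; pose n := (Num.truncn (C / (e * b))).+1; exists n.
have hn : C < n%:R * (e * b) by rewrite -ltr_pdivrMr ?mulr_gt0//; apply: truncnS_gt.
have := bernoulli_decay n (introT andP (conj (ltW b0) b1)).
have q0 : 0 <= (1 - b) ^+ n by rewrite exprn_ge0 // subr_ge0.
set q := (1 - b) ^+ n in q0 *; move=> H.
(* For [b = 1] the power vanishes, and the strict inequality below cannot be multiplied by it. *)
have [->|qn] := eqVneq q 0; first by rewrite mul0r.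
have qp : 0 < q by rewrite lt_def qn.
have : q * C < q * (n%:R * (e * b)) by rewrite ltr_pM2l.
have := ler_wpM2l (ltW e0) H.
have : 0 < e * q by rewrite mulr_gt0.
nra.
Qed.

(** * Domination inside transitive sets *)

Definition dominates (T : finType) (a : rel T) : rel T := fun u v => (u == v) || a u v.

Definition pair_weight (R : realType) (T : finType) (a : rel T)
    (w : {ffun {set T} -> R}) (u v : T) : R :=
  \sum_Z w Z * [&& u \in Z, v \in Z & dominates a u v]%:R.

Lemma dominates_total (T : finType) (a : rel T) :
  is_tournament a -> total (dominates a).
Proof.
case=> _ ta x y; rewrite /dominates; have [//|xy] := eqVneq x y.
by have := ta _ _ xy; case: (a x y) => //= ->; rewrite orbT.
Qed.

Lemma dominates_trans (T : finType) (a : rel T) (S : {set T}) (u v y : T) :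
  transitive_set a S -> u \in S -> v \in S -> y \in S ->
  dominates a u v -> dominates a v y -> dominates a u y.
Proof.
move=> tS uS vS yS /orP[/eqP->//|uv] /orP[/eqP<-|vy].
  by rewrite /dominates uv orbT.
apply/orP; right.
move/forall_inP: tS => /(_ _ uS)/forall_inP/(_ _ vS)/forall_inP/(_ _ yS).
by rewrite uv vy.
Qed.

(** Take [v] in [H] with the fewest dominators in [S]. If it did not dominate some [y] in [H], then
    [y -> v], and by transitivity the dominators of [y] would be a proper subset of those of [v]. *)
Lemma transitive_source (T : finType) (a : rel T) (S H : {set T}) :
  is_tournament a -> transitive_set a S -> H \subset S -> H != set0 ->
  exists2 v, v \in H & {in H, forall y, dominates a v y}.
Proof.
move=> ta tS sHS /set0Pn[v0 v0H].
have [v vH vmin] := arg_minnP (fun v => #|[set u in S | dominates a u v]|%SET) v0H.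
exists v => // y yH; have vS := fintype.subsetP sHS _ vH; have yS := fintype.subsetP sHS _ yH.
have [//|yv] := orP (dominates_total ta v y).
apply: contraT => nvy; have := vmin y yH; rewrite leqNgt => /negP[].
apply: proper_card; apply/properP; split.
  apply/fintype.subsetP => u; rewrite !inE => /andP[uS uy]; rewrite uS /=.
  exact: (dominates_trans tS _ _ _ uy yv).
exists v; rewrite !inE vS /=; first by rewrite /dominates eqxx.
by [].
Qed.

Lemma domination_number_le (T : finType) (a : rel T) (X : {set T}) :
  dominating a X -> (domination_number a <= #|X|)%N.
Proof.
move=> dX; rewrite /domination_number; case: arg_minnP => [|Y _]; last exact.
apply/forallP => v; apply/existsP; exists v.
by rewrite inE eqxx.
Qed.

(** * From a fractional colouring to a dominating set *)

Section Colouring.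
Variables (R : realType) (T : finType) (a : rel T) (w : {ffun {set T} -> R}).
Hypothesis colw : frac_acyclic_colouring a w.

Lemma total_weightE : total_weight a w = \sum_Z w Z.
Proof.
case: colw => _ [w0 _]; rewrite /total_weight [RHS](bigID (transitive_set a)) /=.
by rewrite [X in _ = _ + X]big1 ?addr0 // => Z; apply: w0.
Qed.

Lemma colouring_cover v : 1 <= \sum_Z w Z * (v \in Z)%:R.
Proof.
case: colw => wp [w0 /(_ v)] /le_trans; apply.
rewrite big_mkcond; apply: ler_sum => Z _.
case: ifP => [/andP[_ ->]|_]; first by rewrite mulr1.
by rewrite mulr_ge0.
Qed.

Lemma total_weight_ge1 (v : T) : 1 <= total_weight a w.
Proof.
rewrite total_weightE; apply: le_trans (colouring_cover v) _.
apply: ler_sum => Z _; rewrite ler_piMr ?lern1 ?leq_b1//.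
by case: colw.
Qed.

(* Cauchy-Schwarz: if [q Z] is the [x]-mass of [Z], then the [w]-mean of [q] is
   at least [1 / C], so the form [sum_Z w Z * q Z ^ 2] is at least [X ^ 2 / C],
   and orienting the pairs of [Z] costs at most a factor 2. *)
Lemma pair_weight_reply (C : R) (x : T -> R) :
  is_tournament a -> 0 < C -> total_weight a w <= C -> (0 < #|T|)%N ->
  (forall v, 0 <= x v) ->
  exists u, (2 * C)^-1 * \sum_v x v <= \sum_v x v * pair_weight a w u v.
Proof.
move=> ta C0 wC Tn x0; have [wp _] := colw.
set X := \sum_v x v.
have X0 : 0 <= X by apply: sumr_ge0.
pose q (Z : {set T}) := \sum_v x v * (v \in Z)%:R.
pose F u := \sum_v x v * pair_weight a w u v.
have qX : X <= \sum_Z w Z * q Z.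
  under eq_bigr do rewrite mulr_sumr.
  rewrite exchange_big /=; apply: ler_sum => v _.
  under eq_bigr do rewrite mulrCA.
  by rewrite -mulr_sumr ler_peMr// colouring_cover.
have q2 : X ^+ 2 * C^-1 <= \sum_Z w Z * q Z ^+ 2.
  (* Cauchy-Schwarz in the form of a nonnegative second moment about [X / C]. *)
  have : 0 <= \sum_Z w Z * (q Z - X * C^-1) ^+ 2.
    by apply: sumr_ge0 => Z _; rewrite mulr_ge0 ?sqr_ge0.
  have -> : \sum_Z w Z * (q Z - X * C^-1) ^+ 2 = \sum_Z w Z * q Z ^+ 2
      - 2 * (X * C^-1) * (\sum_Z w Z * q Z) + (X * C^-1) ^+ 2 * \sum_Z w Z.
    rewrite !mulr_sumr -sumrB -big_split /=.
    by apply: eq_bigr => Z _; ring.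
  rewrite total_weightE in wC.
  have k0 : 0 <= X * C^-1 by rewrite mulr_ge0 // invr_ge0 ltW.
  have h1 := ler_wpM2l k0 qX.
  have h2 := ler_wpM2l (sqr_ge0 (X * C^-1)) wC.
  have e1 : (X * C^-1) ^+ 2 * C = X ^+ 2 * C^-1 by field; rewrite gt_eqF.
  have e2 : X * C^-1 * X = X ^+ 2 * C^-1 by ring.
  rewrite e1 in h2; rewrite e2 in h1; lra.
have qF : \sum_Z w Z * q Z ^+ 2 <= 2 * \sum_u x u * F u.
  have xF : \sum_u x u * F u =
      \sum_Z \sum_u \sum_v w Z * (x u * x v * [&& u \in Z, v \in Z & dominates a u v]%:R).
    rewrite exchange_big /=; apply: eq_bigr => u _.
    rewrite exchange_big /= mulr_sumr; apply: eq_bigr => v _.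
    by rewrite /pair_weight !mulr_sumr; apply: eq_bigr => Z _; ring.
  (* The form plus its transpose counts each pair in [Z] at least once, since one of [u], [v]
     dominates the other. *)
  rewrite mulr_natl mulr2n {2}xF xF -big_split /=; apply: ler_sum => Z _.
  rewrite [X in _ <= _ + X]exchange_big -big_split /= expr2 /q mulr_suml mulr_sumr.
  apply: ler_sum => u _; rewrite -big_split mulr_sumr mulr_sumr /=.
  apply: ler_sum => v _; rewrite -mulrDr ler_wpM2l//.
  have := dominates_total ta u v; have : 0 <= x u * x v by rewrite mulr_ge0.
  case: (u \in Z); case: (v \in Z); case: (dominates a u v);
    case: (dominates a v u) => //=; lra.
have sF : \sum_u x u * ((2 * C)^-1 * X) <= \sum_u x u * F u.
  have e : \sum_u x u * ((2 * C)^-1 * X) = 2^-1 * (X ^+ 2 * C^-1).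
    by rewrite -mulr_suml -/X invfM; ring.
  rewrite e; lra.
apply: contrapT => hn.
have Flt u : F u < (2 * C)^-1 * X.
  by rewrite ltNge; apply/negP => h; apply: hn; exists u.
(* If every [F u] is too small, averaging against [x] forces [x = 0], and then [Flt] reads
   [0 < 0]. *)
have x_eq0 : forall u, x u = 0.
  move=> u; apply/eqP; apply: contraT => xu.
  suff : \sum_u x u * F u < \sum_u x u * ((2 * C)^-1 * X) by rewrite ltNge sF.
  rewrite (bigD1 u) //= [ltRHS](bigD1 u) //=; apply: ltr_leD.
    by rewrite ltr_pM2l ?Flt// lt_def xu x0.
  by apply: ler_sum => v _; rewrite ler_wpM2l// ltW.
case/card_gt0P: Tn => u _; have := Flt u.
by rewrite /F /X !big1 ?mulr0 ?ltxx// => v _; rewrite x_eq0 ?mul0r.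
Qed.

(* The sequence [s] stands for a probability distribution of vertices. It
   suffices that a set [Y] hits the first prefix of mass [b] in most of the
   transitive sets: these prefixes depend on the transitive set only. *)
Lemma domination_number_bound (C : R) (n : nat) :
  is_tournament a -> total_weight a w <= C ->
  (1 - (8 * C ^+ 2)^-1) ^+ n * C < (8 * C)^-1 ->
  (domination_number a <= n)%N.
Proof.
move=> ta wC small; have [wp _] := colw.
have [T0|Tn] := posnP #|T|.
  by rewrite (leq_trans (max_card _)) // T0.
have C1 : 1 <= C.
  by case/card_gt0P: Tn => v _; apply: le_trans (total_weight_ge1 v) wC.
have C0 : 0 < C by apply: lt_le_trans C1.
have [||s s0 hs] := @approx_minimax _ _ _ (pair_weight a w) (2 * C)^-1 (4 * C)^-1.
- by move=> x x0; apply: pair_weight_reply.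
- by rewrite ltf_pV2 ?posrE ?mulr_gt0 ?ltr0n// ltr_pM2r// ltr_nat.
set b := (8 * C ^+ 2)^-1 in small.
have b1 : b <= 1 by rewrite invf_le1 ?mulr_gt0 ?exprn_gt0 ?ltr0n//; nra.
pose t : R := (size s)%:R; have t0 : 0 < t by rewrite ltr0n.
pose c (Z : {set T}) v := count (fun u => (u \in Z) && dominates a u v) s.
pose H (Z : {set T}) := finset (fun v => (v \in Z) && (t * b <= (c Z v)%:R)).
have mass v : (8 * C)^-1 <= \sum_(Z | v \in H Z) w Z.
  have bC : b * C = (8 * C)^-1 by rewrite /b; field; rewrite gt_eqF.
  have dC : (4 * C)^-1 = 2 * (8 * C)^-1 by field; rewrite gt_eqF.
  (* Sets in which [v] is heavy contribute at most [t] times their weight, all others together at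
     most [t * b * C]; [b] makes this half of [t / (4 * C)]. *)
  suff : t * (4 * C)^-1 <= t * (\sum_(Z | v \in H Z) w Z + b * C).
    by rewrite ler_pM2l// bC dC; lra.
  apply: le_trans (hs v) _; rewrite exchange_big /=.
  have -> : t * (\sum_(Z | v \in H Z) w Z + b * C) =
      \sum_(Z | v \in H Z) w Z * t + C * (t * b) by rewrite -mulr_suml; ring.
  apply: (@le_trans _ _ (\sum_(Z | v \in H Z) w Z * t + \sum_Z w Z * (t * b))).
    rewrite [X in _ <= X + _]big_mkcond -big_split /=; apply: ler_sum => Z _.
    rewrite -mulr_sumr -natr_sum.
    have -> : (\sum_(u <- s) [&& u \in Z, v \in Z & dominates a u v] =
        if v \in Z then c Z v else 0)%N.
      case: ifP => vZ; last by rewrite big1// => u _; rewrite andbF.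
      by rewrite /c -sum_bool_count.
    have b0 : 0 <= t * b by rewrite mulr_ge0 ?ler0n// invr_ge0 mulr_ge0 ?sqr_ge0.
    rewrite inE; case: ifP => vZ /=; last by rewrite mulr0 add0r mulr_ge0.
    case: (leP (t * b)) => [_|/ltW cb] /=; last by rewrite add0r ler_wpM2l.
    by rewrite -mulrDr ler_wpM2l// ler_wpDr// ler_nat count_size.
  rewrite lerD2l -mulr_suml ler_wpM2r -?total_weightE//.
  by rewrite mulr_ge0 ?ler0n// invr_ge0 mulr_ge0 ?sqr_ge0.
pose P := [pred Z : {set T} | transitive_set a Z && (H Z != set0)].
(* [src Z] is the first heavy vertex of [Z]; the prefix to be hit consists of its dominators in [Z].
   Outside [P] its value is arbitrary. *)
have [src srcP] : exists src : {set T} -> T, forall Z, P Z ->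
    src Z \in H Z /\ {in H Z, forall y, dominates a (src Z) y}.
  have /choice[src srcP] : forall Z, exists u, P Z ->
      u \in H Z /\ {in H Z, forall y, dominates a u y}.
    move=> Z; have [/andP[tZ HZ]|nP] := boolP (P Z).
      have [|u uH uP] := transitive_source ta tZ _ HZ; last by exists u.
      by apply/fintype.subsetP => v; rewrite inE => /andP[].
    by case/card_gt0P: Tn => u _; exists u.
  by exists src.
have [|Y cY hY] := @greedy_hitting_set _ _ _
    (fun u (Z : {set T}) => (u \in Z) && dominates a u (src Z)) P w s b n wp s0 b1.
- by move=> Z /srcP[]; rewrite inE => /andP[].
apply: leq_trans cY; apply: domination_number_le; apply/forallP => v.
(* If [v] is not dominated, [Y] hits the prefix of no transitive [Z] in which [v] is heavy: a hit
   would dominate [src Z], hence [v]. So the weight in [mass v] is all left unhit. *)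
apply: contraT => nv.
suff : (8 * C)^-1 <= (1 - b) ^+ n * C by rewrite leNgt small.
apply: le_trans (mass v) _; apply: le_trans (le_trans _ hY) _; last first.
  rewrite ler_wpM2l ?exprn_ge0 ?subr_ge0//; apply: le_trans wC.
  rewrite total_weightE [leRHS](bigID P) /= lerDl.
  by apply: sumr_ge0.
rewrite big_mkcond [leRHS]big_mkcond /=; apply: ler_sum => Z _.
case: ifP => vH; last by case: ifP.
have [tZ|ntZ] := boolP (transitive_set a Z); last first.
  by case: colw => _ [w0 _]; rewrite w0// if_same.
have PZ : P Z by rewrite /= tZ /=; apply/set0Pn; exists v.
have [sH sP] := srcP _ PZ; have vZ : v \in Z by move: vH; rewrite inE => /andP[].
have sZ : src Z \in Z by move: sH; rewrite inE => /andP[].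
suff -> : [forall u in Y, ~~ ((u \in Z) && dominates a u (src Z))].
  by case/andP: PZ => _ ->.
apply/forall_inP => u uY; apply/negP => /andP[uZ us].
case/negP: nv; apply/existsP; exists u; rewrite uY /=.
exact: (dominates_trans tZ uZ sZ vZ us (sP _ vH)).
Qed.

End Colouring.

(** * Near-optimal colourings and the choice of the bound *)

(** Ensures that the infimum is over a nonempty set. *)
Lemma singletons_colouring (R : realType) (T : finType) (a : rel T) :
  is_tournament a ->
  frac_acyclic_colouring a [ffun S : {set T} => (#|S| == 1%N)%:R : R].
Proof.
move=> [irr _].
have tr1 v : transitive_set a (set1 v).
  apply/forall_inP => x /set1P->; apply/forall_inP => y /set1P->.
  by apply/forall_inP => z /set1P->; rewrite (negbTE (irr v)).
split; first by move=> S; rewrite ffunE ler0n.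
split=> [S nS|v].
  rewrite ffunE; case: eqP => // /eqP/cards1P[v Sv].
  by rewrite Sv tr1 in nS.
rewrite (bigD1 (set1 v)) /= ?tr1 ?set11// ffunE cards1 eqxx lerDl.
by apply: sumr_ge0 => S _; rewrite ffunE ler0n.
Qed.

Lemma frac_acyclic_chromatic_approx (R : realType) (T : finType) (a : rel T) (e : R) :
  is_tournament a -> 0 < e ->
  exists2 w, frac_acyclic_colouring a w &
    total_weight a w < frac_acyclic_chromatic R a + e.
Proof.
move=> ta e0; pose E := [set total_weight a w | w in
  [set w : {ffun {set T} -> R} | frac_acyclic_colouring a w]]%classic.
have infE : has_inf E.
  split; first by eexists; eexists; [exact: singletons_colouring | reflexivity].
  exists 0 => _ [w [w0 _] <-]; exact: sumr_ge0.
by have [_ [w cw <-] lt] := inf_adherent e0 infE; exists w.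
Qed.

Theorem theorem1p12 (R : realType) :
  exists f : R -> nat,
    forall (T : finType) (a : rel T), is_tournament a ->
      (domination_number a <= f (frac_acyclic_chromatic R a))%N.
Proof.
(* [c + 1] bounds the weight of a colouring within 1 of the infimum [c]. If it is below 1, no
   nonempty tournament has the value [c], and [0] is taken. *)
have /choice[f fP] : forall c : R, exists n : nat, 1 <= c + 1 ->
    (1 - (8 * (c + 1) ^+ 2)^-1) ^+ n * (c + 1) < (8 * (c + 1))^-1.
  move=> c; have [c1|] := leP 1 (c + 1); last by exists 0%N.
  have [|||n hn] := @geometric_small R (c + 1) (8 * (c + 1) ^+ 2)^-1 (8 * (c + 1))^-1.
  - by lra.
  - by rewrite invr_gt0 invf_le1; nra.
  - by rewrite invr_gt0; lra.
  by exists n.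
exists f => T a ta.
have [w cw /ltW wC] := frac_acyclic_chromatic_approx ta (@ltr01 R).
have [T0|/card_gt0P[v _]] := posnP #|T|.
  by rewrite (leq_trans (max_card _)) // T0.
apply: (domination_number_bound cw ta wC); apply: fP.
exact: le_trans (total_weight_ge1 cw v) wC.
Qed.
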